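(* For every graph $G$ of order $n$, one has $\chi(G) \le 2\vec{\chi}(G)\left(1+\lfloor \log_2 n\rfloor\right)$.
   Context: $\chi(G)$ is the chromatic number of $G$. For a digraph $D$, a $k$-dicolouring is a map $\phi: V(D)\to\{1,\dots,k\}$ such that each colour class $\phi^{-1}(i)$ induces an acyclic subdigraph (no directed cycle); the dichromatic number $\vec\chi(D)$ is the least $k$ for which a $k$-dicolouring exists. For an undirected graph $G$, $\vec{\chi}(G)$ denotes the maximum of $\vec\chi(\vec G)$ over all orientations $\vec G$ of $G$. *)

(* Defs.v *)
From mathcomp Require Import all_boot.

Set Implicit Arguments.
Unset Strict Implicit.
Unset Printing Implicit Defensive.

Record sgraph := SGraph {
  vertex :> finType;
  edge : rel vertex;
  edge_sym : symmetric edge;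
  edge_irr : irreflexive edge }.

(* Pairs of opposite arcs are allowed (they form a directed cycle of
   length 2); loops are not, since a digraph with a loop has no dicolouring. *)
Record digraph := Digraph {
  dvertex :> finType;
  arc : rel dvertex;
  arc_irr : irreflexive arc }.

Definition proper_colouring (G : sgraph) k (f : {ffun G -> 'I_k}) : bool :=
  [forall x, forall y, edge x y ==> (f x != f y)].

Definition colourable (G : sgraph) k : bool :=
  [exists f : {ffun G -> 'I_k}, proper_colouring f].

Lemma colourable_ex (G : sgraph) : exists k, colourable G k.
Proof.
exists #|G|; apply/existsP; exists [ffun x => enum_rank x].
apply/forallP=> x; apply/forallP=> y; apply/implyP=> exy; rewrite !ffunE.
by apply: contraTneq exy => /enum_rank_inj ->; rewrite edge_irr.
Qed.

Definition chromatic_number (G : sgraph) : nat := ex_minn (colourable_ex G).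

(* A directed cycle visits distinct vertices, so its length is m.+1 for some
   m < #|D|; bounding it makes the predicate boolean (see acyclicP). *)
Definition acyclic (D : digraph) (A : {set D}) : bool :=
  [forall m : 'I_#|D|, forall p : m.+1.-tuple D,
     ~~ [&& all (mem A) p, uniq p & cycle (@arc D) p]].

Lemma acyclicP (D : digraph) (A : {set D}) :
  reflect (forall p : seq D, p != [::] -> {subset p <= A} ->
             ~ ucycle (@arc D) p)
          (acyclic A).
Proof.
apply: (iffP forallP) => [acA p p0 pA /andP[cp up]|acA m].
  have sp : (size p).-1 < #|D|.
    by case: p p0 up {pA cp} => // x p _ /card_uniqP /= <-; apply: max_card.
  have sp1 : size p == (Ordinal sp).+1 by rewrite /=; case: (p) p0.
  move/forallP/(_ (Tuple sp1)): (acA (Ordinal sp)) => /negP; apply.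
  by apply/and3P; split=> //=; apply/allP.
apply/forallP=> p; apply/negP=> /and3P[/allP pA up cp].
apply: (acA p) => //; last by apply/andP.
by rewrite -size_eq0 size_tuple.
Qed.

Definition dicolouring (D : digraph) k (f : {ffun D -> 'I_k}) : bool :=
  [forall i, acyclic [set x | f x == i]].

Definition dicolourable (D : digraph) k : bool :=
  [exists f : {ffun D -> 'I_k}, dicolouring f].

Lemma dicolourable_ex (D : digraph) : exists k, dicolourable D k.
Proof.
exists #|D|; apply/existsP; exists [ffun x => enum_rank x].
apply/forallP=> i; apply/acyclicP=> -[//|x p] _ pA /andP[cp up].
have px y : y \in x :: p -> y = x.
  move=> yp; apply: enum_rank_inj.
  have := pA _ yp; have := pA _ (mem_head x p).
  by rewrite !inE !ffunE => /eqP -> /eqP ->.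
case: p {pA} cp up px => [|y p] /=; first by rewrite arc_irr.
by move=> _ + px; rewrite (px y) ?inE ?eqxx ?orbT.
Qed.

Definition dichromatic_number (D : digraph) : nat :=
  ex_minn (dicolourable_ex D).

Definition is_orientation (G : sgraph) (A : {set G * G}) : bool :=
  [forall x, forall y,
     if edge x y then ((x, y) \in A) (+) ((y, x) \in A) else (x, y) \notin A].

Definition orientation (G : sgraph) := {A : {set G * G} | is_orientation A}.

Definition orientation_arc (G : sgraph) (o : orientation G) : rel G :=
  fun x y => (x, y) \in val o.

Lemma orientation_arc_irr (G : sgraph) (o : orientation G) :
  irreflexive (orientation_arc o).
Proof.
move=> x; have /forallP/(_ x)/forallP/(_ x) := valP o.
by rewrite edge_irr /orientation_arc => /negbTE.
Qed.

Definition orientation_digraph (G : sgraph) (o : orientation G) : digraph :=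
  Digraph (orientation_arc_irr o).

Lemma orientation_ex (G : sgraph) : exists A : {set G * G}, is_orientation A.
Proof.
exists [set u | edge u.1 u.2 && (enum_rank u.1 < enum_rank u.2)].
apply/forallP=> x; apply/forallP=> y; rewrite !inE /= [edge y x]edge_sym.
case exy: (edge x y) => //=; case: ltngtP => // /val_inj/enum_rank_inj xy.
by rewrite xy edge_irr in exy.
Qed.

(* The maximum is over a nonempty finite type, by orientation_ex. *)
Definition graph_dichromatic_number (G : sgraph) : nat :=
  \max_(o : orientation G) dichromatic_number (orientation_digraph o).

(* Main.v *)
Require Import Defs.
From mathcomp Require Import all_boot.

(** Put [L = 1 + trunc_log 2 n], so that [n < 2 ^ L].  Some orientation of [G]
    has no nonempty vertex sequence [s] spanning at least [L * size s] edges,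
    all of which point forward along [s].  Indeed a given [s] is respected by
    at most a [2 ^ -(L * size s)] fraction of the orientations; only the
    sequences none of whose proper prefixes is bad matter, and as each sequence
    has [n < 2 ^ L] one-letter extensions, a Kraft-type induction over prefixes
    bounds the total fraction of bad orientations by [n / 2 ^ L < 1].  For such
    an orientation, a topological ordering of a subset [B] of an acyclic set
    shows that [B] spans fewer than [L * #|B|] edges, so acyclic sets induce
    (2L-1)-degenerate, hence 2L-colourable, subgraphs of [G]. *)

Set Implicit Arguments.
Unset Strict Implicit.
Unset Printing Implicit Defensive.

(** * Counting bit functions *)

(** The bits outside [P] are free, so these functions form a product family; multiplying out avoids
    division. *)
Lemma card_ffun_agree (T : finType) (P : {set T}) (c : T -> bool) :
  #|[set b : {ffun T -> bool} | [forall x in P, b x == c x]]| * 2 ^ #|P|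
    = 2 ^ #|T|.
Proof.
pose F x : pred bool := if x \in P then pred1 (c x) else predT.
have -> : #|[set b : {ffun T -> bool} | [forall x in P, b x == c x]]|
          = #|family F|.
  apply: eq_card => b; rewrite inE; apply/forall_inP/familyP => [bc x|bF x xP].
    by rewrite /F; case: ifP => // /bc.
  by have := bF x; rewrite /F xP.
rewrite card_family foldrE big_map big_enum /= (bigID (mem P)) /=.
rewrite big1 => [|x xP]; last by rewrite /F xP card1.
rewrite (eq_bigr (fun=> 2)) => [|x /negbTE xP]; last first.
  by rewrite /F xP card_bool.
by rewrite prod_nat_const mul1n -expnD addnC cardC.
Qed.

Lemma leq_card_exists (T I : finType) (P : I -> pred T) :
  #|[set x | [exists i, P i x]]| <= \sum_i #|[set x | P i x]|.
Proof.
have -> : [set x | [exists i, P i x]] = \bigcup_i [set x | P i x].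
  apply/setP => x; rewrite inE; apply/existsP/bigcupP => [[i Pi]|[i _]].
    by exists i => //; rewrite inE.
  by rewrite inE; exists i.
elim/big_rec2: _ => [|i A k _ IH]; first by rewrite cards0.
by rewrite (leq_trans (leq_card_setU _ _)) // leq_add.
Qed.

(** * Acyclic sets and topological orderings *)

Lemma acyclicS (D : digraph) (A B : {set D}) :
  B \subset A -> acyclic A -> acyclic B.
Proof.
move=> /subsetP BA /acyclicP acA; apply/acyclicP => p p0 pB.
by apply: acA => // x /pB/BA.
Qed.

(** Without a sink, repeatedly following a chosen arc inside [B] must revisit a vertex and close a
    directed cycle. *)
Lemma acyclic_sink (D : digraph) (B : {set D}) :
  acyclic B -> B != set0 -> exists2 x, x \in B & {in B, forall y, ~~ Defs.arc x y}.
Proof.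
move=> /acyclicP acB /set0Pn[x0 x0B].
have [/exists_inP[x xB /forall_inP xs]|] :=
  boolP [exists x in B, [forall y in B, ~~ Defs.arc x y]]; first by exists x.
rewrite negb_exists_in => /forall_inP noSink.
pose f x := odflt x [pick y in B | Defs.arc x y].
have fP x : x \in B -> (f x \in B) && Defs.arc x (f x).
  move=> xB; rewrite /f; case: pickP => //= noS.
  have := noSink x xB; rewrite negb_forall_in => /exists_inP[y yB].
  by rewrite negbK => xy; have := noS y; rewrite yB xy.
have iB i : iter i f x0 \in B by elim: i => //= i /fP/andP[].
have /trajectP[i ltin loop] := looping_order f x0.
(* [p] runs through the iterates of indices [i] to [n - 1]; iterate [n] returns to iterate [i]. *)
pose n := fingraph.order f x0; pose p := traject f (iter i f x0) (n - i.+1).+1.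
have En : n = i + (n - i.+1).+1 by rewrite addnS -addSn subnKC.
have pB : {subset p <= B} by move=> y /trajectP[j _ ->]; rewrite -iterD.
case: (acB p) => //; apply/andP; split.
  apply: (@sub_in_cycle _ (mem B) (frel f)); last 2 first.
  - exact/allP.
  - rewrite /p /= rcons_path fpath_traject /= last_traject.
    by rewrite -iterS -iterD addnC -En loop.
  by move=> y z /fP/andP[_ yfy] _ /eqP <-.
have := orbit_uniq f x0; rewrite /orbit -/n En trajectD cat_uniq.
by case/and3P.
Qed.

(** Remove a sink, order the rest, put the sink last. *)
Lemma acyclic_ordering (D : digraph) (B : {set D}) :
  acyclic B -> exists s : seq D, [/\ uniq s, s =i B &
    {in B &, forall x y, Defs.arc x y -> index x s < index y s}].
Proof.
have [m] := ubnP #|B|; elim: m B => // m IH B ltBm acB.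
have [->|B0] := eqVneq B set0.
  by exists [::]; split=> // x; rewrite ?inE.
have [x xB xsink] := acyclic_sink acB B0.
have [||s [us sB ord]] := IH (B :\ x).
- by move: ltBm; rewrite (cardsD1 x B) xB.
- exact: acyclicS (subsetDl _ _) acB.
have xs : x \notin s by rewrite sB !inE eqxx.
exists (rcons s x); split.
- by rewrite rcons_uniq xs.
- by move=> y; rewrite mem_rcons inE sB !inE; case: eqVneq => // ->.
move=> y z yB zB yz; have yx : y != x.
  by apply: contraTneq yz => ->; apply: xsink.
have ys : y \in s by rewrite sB !inE yx.
rewrite -cats1 !index_cat ys; case: ifPn => zs.
  by apply: ord => //; rewrite -sB.
by rewrite ltn_addr // index_mem.
Qed.

(** * Greedy colouring of degenerate graphs *)

(** A vertex with fewer than [d] neighbours in the set is coloured last, with a colour that they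
    miss. *)
Lemma degenerate_colouring (G : sgraph) d (A : {set G}) : 0 < d ->
  (forall B : {set G}, B \subset A -> B != set0 ->
     exists2 x, x \in B & #|[set y in B | edge x y]| < d) ->
  exists c : G -> 'I_d, {in A &, forall x y, edge x y -> c x != c y}.
Proof.
move=> d0; have [m] := ubnP #|A|; elim: m A => // m IH A ltAm degA.
have [->|A0] := eqVneq A set0.
  by exists (fun=> Ordinal d0) => x y; rewrite inE.
have [x xA degx] := degA A (subxx _) A0.
have [||c cP] := IH (A :\ x).
- by move: ltAm; rewrite (cardsD1 x A) xA.
- by move=> B /subset_trans BA; apply: degA; apply: BA (subsetDl _ _).
have [i iN] : exists i, i \notin c @: [set y in A | edge x y].
  apply/existsP; rewrite -negb_forall; apply/negP => /forallP iP.
  have := leq_ltn_trans (leq_imset_card c _) degx.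
  rewrite -[X in _ < X]card_ord ltnNge => /negP; apply.
  by apply/subset_leq_card/subsetP => i _; apply: iP.
have ci y : y \in A -> edge x y -> c y != i.
  move=> yA xy; apply: contraNneq iN => <-; apply: imset_f.
  by rewrite inE yA.
exists (fun y => if y == x then i else c y) => y z yA zA yz.
have [yx|yx] := eqVneq y x; have [zx|zx] := eqVneq z x.
- by move: yz; rewrite yx zx edge_irr.
- by rewrite eq_sym ci // -yx.
- by rewrite ci // -zx edge_sym.
- by apply: cP; rewrite ?inE ?yx ?zx.
Qed.

(** * Orientations coded by bits *)

Section RandomOrientation.

Variable G : sgraph.
Implicit Types (s t : seq G) (b : {ffun G * G -> bool}).

Definition rank_lt (x y : G) := enum_rank x < enum_rank y.

(** Listing each edge in increasing rank order counts it once and selects the bit that directs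
    it. *)
Definition spanned (A : {pred G}) : {set G * G} :=
  [set u | [&& edge u.1 u.2, rank_lt u.1 u.2, u.1 \in A & u.2 \in A]].

(* A bit per pair: only the bits of the edges [(x, y)] with [rank_lt x y]
   matter, the edge being directed from [x] to [y] when the bit is set. *)
Definition bits_arcs b : {set G * G} :=
  [set u | edge u.1 u.2 && (if rank_lt u.1 u.2 then b u else ~~ b (u.2, u.1))].

Lemma bits_arcsP b : is_orientation (bits_arcs b).
Proof.
apply/forallP=> x; apply/forallP=> y; rewrite !inE /= [edge y x]edge_sym.
case exy: (edge x y) => //=; rewrite /rank_lt.
case: ltngtP => [_|_|/val_inj/enum_rank_inj xy].
- by case: (b _).
- by case: (b _).
- by rewrite xy edge_irr in exy.
Qed.

Definition bits_orientation b : orientation G :=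
  exist _ (bits_arcs b) (bits_arcsP b).

(** Repetitions in [s] are allowed, [index] taking first occurrences, so every sequence has exactly
    [#|G|] one-letter extensions. *)
Definition forward b s :=
  [forall u in spanned (mem s), b u == (index u.1 s < index u.2 s)].

Lemma forward_cat b s t : forward b (s ++ t) -> forward b s.
Proof.
move=> /forall_inP bst; apply/forall_inP => u.
rewrite inE => /and4P[eu ru u1 u2].
have /bst : u \in spanned (mem (s ++ t)).
  by rewrite inE eu ru /= !mem_cat u1 u2.
by rewrite !index_cat; move: u1 u2; rewrite /= => -> ->.
Qed.

(** Both sides count ordered adjacent pairs in [B]: the increasing ones and their swaps. *)
Lemma handshake (B : {set G}) :
  \sum_(x in B) #|[set y in B | edge x y]| = 2 * #|spanned (mem B)|.
Proof.
pose S := [set u : G * G | [&& edge u.1 u.2, u.1 \in B & u.2 \in B]].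
have -> : \sum_(x in B) #|[set y in B | edge x y]| = #|S|.
  rewrite -sum1_card.
  rewrite (eq_bigr (fun x => \sum_(y | (y \in B) && edge x y) 1)); last first.
    by move=> x _; rewrite -sum1_card; apply: eq_bigl => y; rewrite inE.
  rewrite pair_big_dep; apply: eq_bigl => -[x y]; rewrite !inE /=.
  by rewrite andbA andbC.
pose sw (u : G * G) := (u.2, u.1).
have swK : involutive sw by case.
have -> : S = spanned (mem B) :|: sw @^-1: spanned (mem B).
  apply/setP => -[x y]; rewrite !inE /= [edge y x]edge_sym /rank_lt.
  case: (boolP (edge x y)) => //= exy.
  case: ltngtP => [_|_|/val_inj/enum_rank_inj xy] /=.
  - by rewrite orbF.
  - by rewrite andbC.
  - by rewrite xy edge_irr in exy.
rewrite cardsU disjoint_setI0 ?cards0 ?subn0.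
  by rewrite on_card_preimset ?mul2n -?addnn //; apply: onW_bij; exists sw.
rewrite -setI_eq0; apply/eqP/setP => -[x y]; rewrite !inE /= /rank_lt.
by case: ltngtP; rewrite ?andbF.
Qed.

(** * The Kraft-type bound over prefixes *)

Variable L : nat.
Hypothesis ltGL : #|G| < 2 ^ L.

(** Amounts to: some extension of [s] by at most [d] letters is forward and dense. The fuel [d]
    allows recursion along the prefix tree. *)
Fixpoint bad d b s : bool :=
  forward b s && ((L * size s <= #|spanned (mem s)|) ||
    (if d is d'.+1 then [exists v, bad d' b (rcons s v)] else false)).

Lemma bad_cat d b s t : size t <= d -> forward b (s ++ t) ->
  L * size (s ++ t) <= #|spanned (mem (s ++ t))| -> bad d b s.
Proof.
elim: d s t => [|d IH] s [|v t] //=; rewrite ?cats0.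
- by move=> _ -> ->.
- by move=> _ -> ->.
move=> szt fst lst; rewrite (forward_cat fst) /=; apply/orP; right.
by apply/existsP; exists v; apply: (IH _ t) => //; rewrite cat_rcons.
Qed.

(** The union bound costs a factor [#|G|], less than the [2 ^ L] gained by one more letter; hence
    the strict inequality. *)
Lemma card_bad_step d s :
  (forall v, #|[set b | bad d b (rcons s v)]| * 2 ^ (L * size (rcons s v))
     <= 2 ^ #|{: G * G}|) ->
  #|[set b | [exists v, bad d b (rcons s v)]]| * 2 ^ (L * size s)
    < 2 ^ #|{: G * G}|.
Proof.
move=> leb; rewrite -(@ltn_pmul2r (2 ^ L)) ?expn_gt0 //.
rewrite -mulnA -expnD -mulnSr.
apply: (@leq_ltn_trans (#|G| * 2 ^ #|{: G * G}|)); last first.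
  by rewrite mulnC ltn_pmul2l ?expn_gt0.
apply: leq_trans (leq_mul (leq_card_exists (fun v b => bad d b (rcons s v)))
                          (leqnn _)) _.
rewrite big_distrl -sum_nat_const; apply: leq_sum => v _ /=.
by have := leb v; rewrite size_rcons.
Qed.

(** If [s] is dense, [forward] prescribes at least [L * size s] bits; otherwise badness can only
    come from a one-letter extension. *)
Lemma card_bad d s :
  #|[set b | bad d b s]| * 2 ^ (L * size s) <= 2 ^ #|{: G * G}|.
Proof.
elim: d s => [|d IH] s; have [Ls|Ls] := boolP (L * size s <= #|spanned (mem s)|).
1,3: rewrite -(card_ffun_agree (spanned (mem s))
                 (fun u => index u.1 s < index u.2 s)).
1,2: apply: leq_mul; last by rewrite leq_exp2l.
1,2: by apply/subset_leq_card/subsetP => b; rewrite !inE /=; case/andP.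
- have -> : [set b | bad 0 b s] = set0.
    by apply/setP => b; rewrite !inE /= (negbTE Ls) andbF.
  by rewrite cards0.
apply: leq_trans (ltnW (card_bad_step (fun v => IH (rcons s v)))).
rewrite leq_mul2r; apply/orP; right.
apply/subset_leq_card/subsetP => b.
by rewrite !inE /= (negbTE Ls) => /andP[].
Qed.

Lemma good_bits : exists b, forall s, s != [::] -> size s <= #|G| ->
  forward b s -> #|spanned (mem s)| < L * size s.
Proof.
pose X := [set b | [exists v, bad #|G| b [:: v]]].
have [b] : exists b, b \notin X.
  apply/existsP; rewrite -negb_forall; apply/negP => /forallP XT.
  (* At the empty sequence the weight [2 ^ 0] is 1, so strictness leaves a bit function outside
     [X]. *)
  have := card_bad_step (fun v => card_bad #|G| (rcons [::] v)).
  rewrite muln0 muln1 (_ : [set _ | _] = setT); last first.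
    by apply/setP => b; rewrite in_setT; apply: XT.
  by rewrite cardsT card_ffun card_bool ltnn.
move=> bX; exists b => -[//|v s] _ szs fs; rewrite ltnNge.
apply: contra bX => Ls; rewrite inE; apply/existsP; exists v.
by apply: (@bad_cat _ _ _ s) => //; apply: ltnW.
Qed.

(** A topological ordering of [A] is a forward sequence, to which the hypothesis on [b] applies. *)
Lemma acyclic_sparse b (A : {set orientation_digraph (bits_orientation b)}) :
  (forall s, s != [::] -> size s <= #|G| ->
     forward b s -> #|spanned (mem s)| < L * size s) ->
  acyclic A -> A != set0 -> #|spanned (mem A)| < L * #|A|.
Proof.
move=> good acA A0; have [s [us sA ord]] := acyclic_ordering acA.
have szs : size s = #|A| by rewrite -(card_uniqP us); apply: eq_card.
have spE : spanned (mem A) = spanned (mem s).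
  by apply/setP => u; rewrite !inE !sA.
rewrite spE -szs; apply: good.
- by rewrite -size_eq0 szs cards_eq0.
- by rewrite szs max_card.
apply/forall_inP => -[x y]; rewrite inE /= => /and4P[exy rxy xs ys].
move: xs ys; rewrite !sA => xA yA.
have arcE u : @Defs.arc (orientation_digraph (bits_orientation b)) u.1 u.2 = (u \in bits_arcs b).
  by case: u.
case bxy: (b (x, y)).
  by rewrite ord // (arcE (x, y)) inE /= exy rxy.
(* A clear bit gives the arc from [y] to [x], so [y] comes first in [s]. *)
rewrite eq_sym eqbF_neg -leqNgt ltnW // ord //.
by rewrite (arcE (y, x)) inE /= edge_sym exy bxy /rank_lt ltnNge ltnW.
Qed.

End RandomOrientation.

(** * Colouring each dicolour class separately *)

Theorem mainTheorem2 (G : sgraph) (n : nat) (hn : #|G| = n) :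
  chromatic_number G <= 2 * graph_dichromatic_number G * (1 + trunc_log 2 n).
Proof.
set L := 1 + trunc_log 2 n.
have ltGL : #|G| < 2 ^ L by rewrite hn /L add1n trunc_log_ltn.
have [b good] := good_bits ltGL.
pose o := bits_orientation b; pose D := orientation_digraph o.
have leD : dichromatic_number D <= graph_dichromatic_number G.
  exact: (leq_bigmax (F := fun o => dichromatic_number (orientation_digraph o))).
have [f /forallP fP] : exists f : {ffun D -> 'I_(dichromatic_number D)},
    dicolouring f.
  by apply/existsP; rewrite /dichromatic_number; case: ex_minnP.
have L2 : 0 < 2 * L by rewrite muln_gt0.
have colP i : exists c : G -> 'I_(2 * L),
    {in [set x | f x == i] &, forall x y, edge x y -> c x != c y}.
  apply: (@degenerate_colouring G) => // B BA B0.
  have sparse := acyclic_sparse good (@acyclicS D _ B BA (fP i)) B0.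
  (* If every vertex of [B] had at least [2 * L] neighbours in [B], [handshake] would give at least
     [L * #|B|] edges. *)
  apply/exists_inP; apply: contraLR sparse; rewrite negb_exists_in => /forall_inP dB.
  rewrite -leqNgt -(leq_pmul2l (ltn0Sn 1)) -handshake mulnA mulnC -sum_nat_const.
  by apply: leq_sum => x /dB; rewrite -leqNgt.
have [c cP] := fin_all_exists colP.
have colG : colourable G #|{: 'I_(dichromatic_number D) * 'I_(2 * L)}|.
  (* Each vertex gets its dicolour class paired with its colour inside that class. *)
  apply/existsP; exists [ffun x => enum_rank (f x, c (f x) x)].
  apply/forallP => x; apply/forallP => y; apply/implyP => exy; rewrite !ffunE.
  rewrite (inj_eq enum_rank_inj); apply/eqP => -[fxy cxy].
  have := cP (f x) x y; rewrite !inE -fxy eqxx => /(_ isT isT exy).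
  by rewrite cxy -fxy eqxx.
apply: leq_trans (_ : dichromatic_number D * (2 * L) <= _); last first.
  by rewrite mulnA leq_mul2r [2 * _]mulnC leq_mul2r leD orbT.
have := colG; rewrite card_prod !card_ord /chromatic_number.
by case: ex_minnP => m _; apply.
Qed.
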